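(* Let $a=(a_k)_{k\in\mathbb{N}}\in\ell^\infty$ be periodic of period $N\in\mathbb{N}$. If there exist $i,j\in\{1,\dots,N\}$ with $i\ne j$ such that $|a_i|\ne|a_j|$, then $$r(T_a)\ <\ \frac1N\sum_{k=1}^{N}|a_k|\ \le\ \|a\|_w\ <\ \max\{|a_1|,\dots,|a_N|\},$$ i.e. $T_a$ is non-normaloid and non-convexoid.
   Context: $\mathbb{N}=\{1,2,3,\dots\}$. $\ell^2$ is the complex Hilbert space of square-summable unilateral sequences $(x_k)_{k\in\mathbb{N}}$, and $\ell^\infty$ the space of bounded complex sequences. A sequence $a$ is periodic of period $N$ if $a_{k+N}=a_k$ for all $k\in\mathbb{N}$. For $a\in\ell^\infty$, the (unilateral) weighted forward shift $T_a:\ell^2\to\ell^2$ is the bounded operator $T_a(x_1,x_2,\dots)=(0,a_1x_1,a_2x_2,\dots)$, and $r(T_a)$ is its spectral radius. For a bounded operator $T$ on a complex Hilbert space $H$, the numerical range is $W(T)=\{\langle Tx,x\rangle : x\in H,\ \|x\|=1\}$ and the numerical radius is $w(T)=\sup\{|\lambda| : \lambda\in W(T)\}$; $T$ is called normaloid if $w(T)=\|T\|$, and convexoid if $\overline{W(T)}=\operatorname{conv}\sigma(T)$ (the convex hull of the spectrum). Set $\|a\|_w:=w(T_a)$. *)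

(* Defs.v *)
(* Complex numbers are [R[i]] over [R : realType].

   [R[i]^o] is [R[i]] seen as a normed module over itself: it is the form on
   which the usual topology of the complex plane is inferred.

   Sequences indexed by {1, 2, 3, ...} are functions on [nat]: the value
   [x k] is the term usually written x_(k+1). *)
From HB Require Import structures.
From mathcomp Require Import all_boot all_order all_algebra ring.
From mathcomp Require Import all_classical all_reals all_analysis.
From mathcomp Require Import complex.

Set Implicit Arguments.
Unset Strict Implicit.
Unset Printing Implicit Defensive.

Import Order.TTheory GRing.Theory Num.Theory numFieldNormedType.Exports.

Local Open Scope classical_set_scope.
Local Open Scope ring_scope.
Local Open Scope complex_scope.

(* The modulus as an element of [R]; the norm [`|z|] of [R[i]] is [(normc z)%:C]. *)
Notation normc := ComplexField.Normc.normc.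

(* [sup] is 0 on a set with no supremum.  This default is never used for a
   bounded operator on a nonzero Hilbert space: the sets below are then nonempty
   and bounded. *)
Section operators.
Variables (R : realType) (V : lmodType R[i]).
Variable dot : {dot V for @Num.conj R[i]}.
Implicit Types T S : V -> V.

Definition hnorm (x : V) : R := Num.sqrt (complex.Re (dot x x)).

Definition bounded_op T : Prop :=
  linear T /\ exists M : R, forall x, hnorm (T x) <= M * hnorm x.

Definition op_norm T : R := sup [set hnorm (T x) | x in [set x | hnorm x <= 1]].

Definition spectrum T : set R[i] :=
  [set z | ~ exists S, [/\ bounded_op S,
                           cancel (fun x => T x - z *: x) S &
                           cancel S (fun x => T x - z *: x)]].

Definition spectral_radius T : R := sup [set normc z | z in spectrum T].

Definition numerical_range T : set R[i] :=
  [set dot (T x) x | x in [set x | hnorm x = 1]].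

Definition numerical_radius T : R := sup [set normc z | z in numerical_range T].

Definition normaloid T : Prop := numerical_radius T = op_norm T.

(* [{i01 R[i]}] consists of the real weights in [0, 1], because the order of
   [R[i]] only compares numbers with the same imaginary part. *)
Definition convex_hull (A : set R[i]^o) : set R[i]^o :=
  smallest (@convex_set R[i] R[i]^o) A.

Definition convexoid T : Prop :=
  closure (numerical_range T : set R[i]^o) = convex_hull (spectrum T).

End operators.

Section complex_series.
Variable R : realType.
Implicit Types (u : nat -> R[i]) (z : R[i]).

Lemma normc_ge0 z : 0 <= normc z.
Proof. by case: z => x y; exact: sqrtr_ge0. Qed.

Lemma Re_normr z : complex.Re `|z| = normc z.
Proof. by case: z. Qed.

Lemma normrE_normc z : `|z| = (normc z)%:C.
Proof. by case: z. Qed.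

Lemma sqr_normc z : normc z ^+ 2 = complex.Re z ^+ 2 + complex.Im z ^+ 2.
Proof. by case: z => x y /=; rewrite sqr_sqrtr// addr_ge0// sqr_ge0. Qed.

Lemma ler_Re_normc z : `|complex.Re z| <= normc z.
Proof.
rewrite -(@ler_pXn2r _ 2) ?nnegrE ?normc_ge0// sqr_normc real_normK ?num_real//.
by rewrite lerDl sqr_ge0.
Qed.

Lemma ler_Im_normc z : `|complex.Im z| <= normc z.
Proof.
rewrite -(@ler_pXn2r _ 2) ?nnegrE ?normc_ge0// sqr_normc real_normK ?num_real//.
by rewrite lerDr sqr_ge0.
Qed.

Lemma ler_normc_ReIm z : normc z <= `|complex.Re z| + `|complex.Im z|.
Proof.
rewrite -(@ler_pXn2r _ 2) ?nnegrE ?normc_ge0 ?addr_ge0//.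
rewrite sqr_normc sqrrD !real_normK ?num_real// addrAC lerDl.
by rewrite mulrn_wge0// mulr_ge0.
Qed.

Lemma conjCE z : z^*%R = conjc z.
Proof. by []. Qed.

Lemma normc_conj z : normc (z^*)%R = normc z.
Proof. by case: z => x y; rewrite conjCE /= sqrrN. Qed.

Lemma cvg_complex (u : nat -> R[i]^o) (a b : R) :
  complex.Re (u n) @[n --> \oo] --> a -> complex.Im (u n) @[n --> \oo] --> b ->
  u @ \oo --> (a +i* b : R[i]^o).
Proof.
move=> ua ub; apply/cvgrPdist_lt => e e0.
have /complex_realP[r er] : e \is Num.real by rewrite gtr0_real.
have r0 : 0 < r / 2 by move: e0; rewrite er ltcR => r0; rewrite divr_gt0.
move/cvgrPdist_lt/(_ _ r0) : ua => ua.
move/cvgrPdist_lt/(_ _ r0) : ub => ub.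
near=> n.
rewrite normrE_normc er ltcR (le_lt_trans (ler_normc_ReIm _))//.
rewrite [ltRHS](splitr r) ltrD//.
- have : `|a - complex.Re (u n)| < r / 2 by near: n.
  by case: (u n).
- have : `|b - complex.Im (u n)| < r / 2 by near: n.
  by case: (u n).
Unshelve. all: by end_near. Qed.

Lemma cvg_series_complex (u : nat -> R[i]^o) (a b : R) :
  series (@complex.Re R \o u) @ \oo --> a ->
  series (@complex.Im R \o u) @ \oo --> b ->
  series u @ \oo --> (a +i* b : R[i]^o).
Proof.
have E n : series u n =
    series (@complex.Re R \o u) n +i* series (@complex.Im R \o u) n :> R[i].
  elim: n => [|n IH]; first by rewrite /series /= !big_geq.
  rewrite !seriesSr [LHS]/(series u n + u n) IH.
  rewrite -[(_ \o _) n]/(complex.Re (u n)).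
  rewrite -[(@complex.Im R \o _) n]/(complex.Im (u n)).
  by case: (u n) => x y.
move=> ua ub; apply: cvg_complex.
  rewrite (_ : (fun n => _) = series (@complex.Re R \o u))//.
  by apply/funext => n; rewrite E.
rewrite (_ : (fun n => _) = series (@complex.Im R \o u))//.
by apply/funext => n; rewrite E.
Qed.

Lemma is_cvg_series_complex (u : nat -> R[i]^o) :
  cvgn (series (fun n => normc (u n))) -> cvgn (series u).
Proof.
move=> cu; have cpart (f : R[i] -> R) :
    (forall z, `|f z| <= normc z) -> cvgn (series (f \o u)).
  move=> fle; apply: normed_cvg; apply: series_le_cvg cu => n //=.
  exact: normc_ge0.
apply/cvg_ex; eexists.
apply: cvg_series_complex; [apply: cpart|apply: cpart].
- exact: ler_Re_normc.
- exact: ler_Im_normc.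
Qed.

End complex_series.

Section ell2.
Variable R : realType.

Definition square_summable : {pred nat -> R[i]} :=
  fun x => `[< cvgn (series (fun k => normc (x k) ^+ 2)) >].

Fact square_summable_submod : submod_closed square_summable.
Proof.
split=> [|c x y].
  apply/asboolP; apply: is_cvg_near_cst.
  near=> n; rewrite /series /= big1// => k _ /=.
  by rewrite expr0n/= addr0 sqrtr0 expr0n.
move=> /asboolP cx /asboolP cy; apply/asboolP.
have c2 := is_cvg_seriesD (is_cvg_seriesZ (k := 2 * normc c ^+ 2) cx)
                          (is_cvg_seriesZ (k := 2) cy).
have c2E k : 2 * (normc (c * x k) ^+ 2 + normc (y k) ^+ 2) =
    2 * normc c ^+ 2 * normc (x k) ^+ 2 + 2 * normc (y k) ^+ 2.
  by rewrite ComplexField.Normc.normcM exprMn mulrDr mulrA.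
apply: (series_le_cvg _ _ _ c2) => k; rewrite ?sqr_ge0//.
  rewrite -[leRHS]/(2 * normc c ^+ 2 * normc (x k) ^+ 2 + 2 * normc (y k) ^+ 2).
  apply: addr_ge0; apply: mulr_ge0; rewrite ?sqr_ge0//.
  by apply: mulr_ge0; rewrite ?sqr_ge0.
rewrite -[leRHS]/(2 * normc c ^+ 2 * normc (x k) ^+ 2 + 2 * normc (y k) ^+ 2).
rewrite -c2E.
apply: (@le_trans _ _ ((normc (c * x k) + normc (y k)) ^+ 2)).
  rewrite ler_pXn2r// ?nnegrE ?addr_ge0 ?normc_ge0//.
  exact: le_normcD.
set s := normc _; set t := normc _.
rewrite -subr_ge0 (_ : _ - _ = (s - t) ^+ 2) ?sqr_ge0//.
by rewrite sqrrB sqrrD; ring.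
Unshelve. all: by end_near. Qed.

HB.instance Definition _ :=
  GRing.isSubmodClosed.Build R[i] (nat -> R[i]) square_summable
    square_summable_submod.

Record ell2 := Ell2 {
  ell2_seq :> nat -> R[i] ;
  ell2_subproof : ell2_seq \in square_summable }.

HB.instance Definition _ := [isSub for ell2_seq].
HB.instance Definition _ := [Choice of ell2 by <:].
HB.instance Definition _ := [SubChoice_isSubLmodule of ell2 by <:].

Implicit Types x y : ell2.

Lemma ell2P x : cvgn (series (fun k => normc (x k) ^+ 2)).
Proof. by have /asboolP := ell2_subproof x. Qed.

Definition ell2_dot x y : R[i] :=
  limn (series (fun k => x k * (y k)^*%R : R[i]^o)).

Lemma ell2_dot_cvg x y :
  series (fun k => x k * (y k)^*%R : R[i]^o) @ \oo --> (ell2_dot x y : R[i]^o).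
Proof.
apply: is_cvg_series_complex.
have c2 := is_cvg_seriesD (@ell2P x) (@ell2P y).
apply: series_le_cvg c2 => [k|k|k] /=; rewrite ?normc_ge0//.
  by rewrite addr_ge0// sqr_ge0.
rewrite ComplexField.Normc.normcM normc_conj.
rewrite -[leRHS]/(normc (x k) ^+ 2 + normc (y k) ^+ 2).
set s := normc _; set t := normc _.
have st0 : 0 <= s * t by rewrite mulr_ge0 ?normc_ge0.
rewrite -subr_ge0 (_ : _ - _ = (s - t) ^+ 2 + s * t) ?addr_ge0 ?sqr_ge0//.
by rewrite sqrrB; ring.
Qed.

Lemma ell2_dot_linearl y : scalar (ell2_dot^~ y).
Proof.
move=> c u v; apply: (@cvg_lim R[i]^o); first exact: norm_hausdorff.
have -> : series (fun k => (c *: u + v : ell2) k * (y k)^*%R : R[i]^o) =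
   c *: series (fun k => u k * (y k)^*%R : R[i]^o)
   + series (fun k => v k * (y k)^*%R : R[i]^o).
  rewrite -seriesZ -seriesD; congr series; apply/funext => k.
  rewrite -[LHS]/((c * u k + v k) * (y k)^*%R).
  by rewrite mulrDl -mulrA.
apply: cvgD; last exact: ell2_dot_cvg.
by apply: cvgZl_tmp; exact: ell2_dot_cvg.
Qed.

Lemma ell2_dotC x y : ell2_dot x y = (ell2_dot y x)^*%R.
Proof.
apply: (@cvg_lim R[i]^o); first exact: norm_hausdorff.
have := @ell2_dot_cvg y x; set l := ell2_dot y x => /cvgrPdist_lt cl.
apply/cvgrPdist_lt => e e0; near=> n.
have : `|l - series (fun k => y k * (x k)^*%R : R[i]^o) n| < e by near: n; exact: cl.
rewrite -norm_conjC rmorphB /series/= rmorph_sum/=.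
under eq_bigr do rewrite rmorphM/= conjCK mulrC.
by [].
Unshelve. all: by end_near. Qed.

Lemma ell2_dot_linearr x : linear_for (@Num.conj R[i] \; *%R) (ell2_dot x).
Proof.
move=> c u v; rewrite ell2_dotC ell2_dot_linearl rmorphD rmorphM/=.
by rewrite -!ell2_dotC.
Qed.

Lemma ell2_dot_hermitian x y : ell2_dot x y = (-1) ^+ false * (ell2_dot y x)^*%R.
Proof. by rewrite expr0 mul1r ell2_dotC. Qed.

Lemma ell2_dotxx x :
  ell2_dot x x = (limn (series (fun k => normc (x k) ^+ 2)))%:C.
Proof.
apply: (@cvg_lim R[i]^o); first exact: norm_hausdorff.
have E k : x k * (x k)^*%R = (normc (x k) ^+ 2)%:C.
  by rewrite -normCK normrE_normc rmorphXn.
apply: cvg_series_complex => /=.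
  under eq_fun do rewrite E/=.
  exact: ell2P.
under eq_fun do rewrite E/=.
apply: cvg_near_cst; near=> n; rewrite /series /= big1//.
Unshelve. all: by end_near. Qed.

Lemma ell2_dot_gt0 x : x != 0 -> 0 < ell2_dot x x.
Proof.
move=> x0; rewrite ell2_dotxx ltcR.
have [k xk0] : exists k, x k != 0.
  apply: contrapT => /forallNP x0'; move/eqP: x0; apply.
  by apply/val_inj/funext => k; apply/eqP; apply: contrapT => /negP /x0'.
apply: (@lt_le_trans _ _ (normc (x k) ^+ 2)).
  rewrite exprn_gt0// lt_def normc_ge0 andbT.
  by apply: contra xk0 => /eqP/ComplexField.Normc.eq0_normc ->.
apply: (@le_trans _ _ (series (fun k => normc (x k) ^+ 2) k.+1)).
  rewrite seriesSr lerDr /series/= sumr_ge0// => j _; exact: sqr_ge0.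
apply: nondecreasing_cvgn_le; last exact: ell2P.
by apply: nondecreasing_series => j _ _; exact: sqr_ge0.
Qed.

HB.instance Definition _ := @bilinear_isBilinear.Build R[i] ell2 ell2 R[i]
  ( *%R ) (@Num.conj R[i] \; *%R) ell2_dot
  (conj ell2_dot_linearl ell2_dot_linearr).
HB.instance Definition _ := @isHermitianSesquilinear.Build R[i] ell2 false
  (@Num.conj R[i]) ell2_dot ell2_dot_hermitian.
HB.instance Definition _ := @isDotProduct.Build R[i] ell2 ell2_dot ell2_dot_gt0.

End ell2.

Section weighted_shift.
Variable R : realType.

Record ellinf := Ellinf {
  ellinf_seq :> nat -> R[i] ;
  ellinf_bounded : bounded_fun (ellinf_seq : nat -> R[i]^o) }.

Lemma ellinfP (a : ellinf) : exists2 M : R, 0 <= M & forall k, normc (a k) <= M.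
Proof.
have [M [Mreal aM]] := ellinf_bounded a.
have /complex_realP[m mM] : Num.max 0 M + 1 \is Num.real.
  by rewrite realD// max_real.
have le0m : 0 <= m.
  by rewrite -ler0c -mM addr_ge0// comparable_le_max ?lexx// real_comparable.
exists m => // k.
rewrite -lecR -normrE_normc -mM; apply: aM => //.
by rewrite ltr_pwDr// comparable_le_max ?lexx ?orbT// real_comparable.
Qed.

Variable a : ellinf.

Definition wshift_seq (x : nat -> R[i]) : nat -> R[i] :=
  fun k => if k is j.+1 then a j * x j else 0.

Lemma wshift_series (x : nat -> R[i]) n :
  series (fun k => normc (wshift_seq x k) ^+ 2) n.+1 =
  series (fun k => normc (a k * x k) ^+ 2) n.
Proof.
rewrite /series /= big_nat_recl//= expr0n/= addr0 sqrtr0 expr0n/= add0r.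
by [].
Qed.

Lemma wshift_cvg (x : ell2 R) :
  cvgn (series (fun k => normc (a k * x k) ^+ 2)).
Proof.
have [M M0 aM] := ellinfP a.
have c2 := is_cvg_seriesZ (k := M ^+ 2) (@ell2P _ x).
apply: (series_le_cvg _ _ _ c2) => k; rewrite ?sqr_ge0//.
  by apply: mulr_ge0; rewrite sqr_ge0.
rewrite -[leRHS]/(M ^+ 2 * normc (x k) ^+ 2) ComplexField.Normc.normcM exprMn.
by rewrite ler_wpM2r ?sqr_ge0// ler_pXn2r// nnegrE normc_ge0.
Qed.

Fact wshift_subproof (x : ell2 R) : wshift_seq x \in @square_summable R.
Proof.
apply/asboolP/cvg_ex; exists (limn (series (fun k => normc (a k * x k) ^+ 2))).
rewrite -cvg_shiftS.
rewrite (_ : [sequence _]_n = series (fun k => normc (a k * x k) ^+ 2)).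
  exact: wshift_cvg.
by apply/funext => n; rewrite -wshift_series.
Qed.

Definition wshift (x : ell2 R) : ell2 R := Ell2 (wshift_subproof x).

Lemma wshift_linear : linear wshift.
Proof.
move=> c x y; apply/val_inj/funext => -[|k] /=.
  by rewrite -[RHS]/(c * 0 + 0) mulr0 addr0.
rewrite -[LHS]/(a k * (c * x k + y k)) -[RHS]/(c * (a k * x k) + a k * y k).
by rewrite mulrDr mulrCA.
Qed.

HB.instance Definition _ :=
  GRing.isLinear.Build R[i] (ell2 R) (ell2 R) *:%R wshift wshift_linear.

Lemma wshift_bounded : bounded_op (@ell2_dot R) wshift.
Proof.
split; first exact: wshift_linear.
have [M M0 aM] := ellinfP a; exists M => x.
rewrite /hnorm -[leLHS]/(Num.sqrt (complex.Re (ell2_dot (wshift x) (wshift x)))).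
rewrite -[X in _ * X]/(Num.sqrt (complex.Re (ell2_dot x x))) !ell2_dotxx /=.
rewrite -(ger0_norm M0) -sqrtr_sqr -sqrtrM ?sqr_ge0// ler_sqrt; last first.
  rewrite mulr_ge0 ?sqr_ge0//; apply: limr_ge; first exact: ell2P.
  by apply: nearW => n; rewrite sumr_ge0// => k _; exact: sqr_ge0.
have cM : series (fun k => M ^+ 2 * normc (x k) ^+ 2) @ \oo -->
    M ^+ 2 * limn (series (fun k => normc (x k) ^+ 2)).
  rewrite (_ : series _ = (fun n => M ^+ 2 * series (fun k => normc (x k) ^+ 2) n)).
    by apply: cvgMl_tmp; exact: ell2P.
  by apply/funext => n; rewrite /series/= mulr_sumr.
have cw : series (fun k => normc (wshift x k) ^+ 2) @ \oo -->
    limn (series (fun k => normc (a k * x k) ^+ 2)).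
  rewrite -cvg_shiftS.
  rewrite (_ : [sequence _]_n = series (fun k => normc (a k * x k) ^+ 2)).
    exact: wshift_cvg.
  by apply/funext => n; rewrite -wshift_series.
rewrite (cvg_lim (@Rhausdorff R) cw) -(cvg_lim (@Rhausdorff R) cM).
apply: lim_series_le; [exact: wshift_cvg|by apply/cvg_ex; eexists; exact: cM|].
move=> n; rewrite ComplexField.Normc.normcM exprMn.
by rewrite ler_wpM2r ?sqr_ge0// ler_pXn2r// nnegrE normc_ge0.
Qed.

Definition wnorm : R := numerical_radius (@ell2_dot R) wshift.

End weighted_shift.

(* Main.v *)
Require Import Defs.
From mathcomp Require Import all_boot all_order all_algebra ring lra.
From mathcomp Require Import all_classical all_reals all_analysis.
From mathcomp Require Import complex.
Import Order.TTheory GRing.Theory Num.Theory.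
Local Open Scope ring_scope.

Set Implicit Arguments.
Unset Strict Implicit.
Unset Printing Implicit Defensive.

(** Write [alpha k] for the modulus of the [k]-th weight, [A] for its mean over
    a period and [M] for its maximum, so that [0 < A < M].  Two auxiliary
    positive sequences carry the two strict inequalities.  Both are built by
    summing periodic sequences of mean zero, whose partial sums are again
    periodic, hence bounded ([periodic_primitive]).

    Spectral radius.  It is enough to find a bounded sequence [s] and some
    [rho < A] such that [alpha k * exp (s (k+1)) <= rho * exp (s k)]: conjugating
    the shift by the bounded, boundedly invertible diagonal operator with
    entries [exp (s k)] then gives a shift of norm at most [rho].  Such an [s]
    comes from the inequality [x * exp (1 - x) <= 1], strict unless [x = 1],
    which plays the role of the inequality between the arithmetic and geometric
    means ([lt_mean_weights]).  For [rho < |z|] the equation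
    [(T - z) x = y] is solved coordinate by coordinate, and the weighted
    estimate shows that the solution operator is bounded ([notin_spectrum]).

    Upper bound for the numerical radius.  By the Schur test, [w (T) <= lambda]
    as soon as there is a positive sequence [v] with
    [alpha (k-1) * v (k-1) + alpha k * v (k+1) <= 2 * lambda * v k].  The
    constant sequence achieves [lambda = M]; correcting it by a periodic
    solution of a discrete Poisson equation, whose source is the sum of two
    neighbouring deficits [M - alpha] minus its mean, achieves some
    [lambda < M] ([lt_max_supersolution]).

    Lower bound for the numerical radius.  A unit vector of constant modulus on
    its first [m+1] coordinates, with phases that make all the products in
    [<T x, x>] nonnegative, gives the value
    [(alpha 0 + ... + alpha (m-1)) / (m+1)], which tends to [A]
    ([numerical_range_flat]).

    Finally, [M <= ||T||] makes [T] non-normaloid.  The convex hull of the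
    spectrum lies in the disc of radius [rho], while the numerical range leaves
    this disc because [rho < A <= w (T)]; so [T] is non-convexoid. *)

Import numFieldNormedType.Exports.

(** * Periodic sequences *)

Section periodic_sequences.
Variables (R : realFieldType) (N : nat).
Hypothesis N_gt0 : (0 < N)%N.
Implicit Types (f g : nat -> R) (k : nat).

Definition mean f : R := N%:R^-1 * \sum_(i < N) f i.

Lemma periodic_modn (T : Type) (f : nat -> T) k :
  (forall k, f (k + N)%N = f k) -> f k = f (k %% N)%N.
Proof.
move=> fN; rewrite {1}(divn_eq k N).
elim: (k %/ N)%N => [|m IH]; first by rewrite mul0n add0n.
by rewrite mulSn -addnA addnC fN.
Qed.

Lemma periodic_bounded f : (forall k, f (k + N)%N = f k) ->
  exists2 B, 0 <= B & forall k, `|f k| <= B.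
Proof.
move=> fN; exists (\sum_(i < N) `|f i|); first by apply: sumr_ge0.
move=> k; rewrite (periodic_modn _ fN).
rewrite (bigD1 (Ordinal (ltn_pmod k N_gt0)))//= lerDl.
exact: sumr_ge0.
Qed.

Lemma sum_shift_period f k : (forall k, f (k + N)%N = f k) ->
  \sum_(k <= i < k + N) f i = \sum_(i < N) f i.
Proof.
move=> fN; elim: k => [|k IH]; first by rewrite add0n big_mkord.
have lt_k : (k < k + N)%N by rewrite -[ltnLHS]addn0 ltn_add2l.
by rewrite -IH addSn big_nat_recr//= fN [RHS]big_ltn// addrC.
Qed.

Lemma partial_sum_periodic f : (forall k, f (k + N)%N = f k) ->
  mean f = 0 -> forall k, \sum_(0 <= i < k + N) f i = \sum_(0 <= i < k) f i.
Proof.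
move=> fN /eqP; rewrite mulf_eq0 invr_eq0 pnatr_eq0 -leqn0 leqNgt N_gt0/=.
move=> /eqP f0 k.
by rewrite (@big_cat_nat _ _ _ k) ?leq_addr//= sum_shift_period// f0 addr0.
Qed.

Lemma meanB f g : mean (fun k => f k - g k) = mean f - mean g.
Proof. by rewrite /mean sumrB mulrBr. Qed.

Lemma meanZ c f : mean (fun k => c * f k) = c * mean f.
Proof. by rewrite /mean -mulr_sumr mulrCA. Qed.

Lemma mean_cst c : mean (fun=> c) = c.
Proof.
by rewrite /mean sumr_const card_ord -[c *+ _]mulr_natl mulKf// pnatr_eq0 -lt0n.
Qed.

Lemma mean_gt0 f : (forall k, 0 <= f k) -> (exists i : 'I_N, 0 < f i) ->
  0 < mean f.
Proof.
move=> f0 [i fi]; rewrite mulr_gt0 ?invr_gt0 ?ltr0n//.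
by rewrite (bigD1 i)//= ltr_wpDr// sumr_ge0.
Qed.

(** Over one period the partial sums of [f] grow by the sum over a period, which
    is zero; so the discrete primitive of [f] is periodic too. *)
Lemma periodic_primitive f : (forall k, f (k + N)%N = f k) -> mean f = 0 ->
  exists s, [/\ forall k, s (k + N)%N = s k,
                forall k, s k.+1 - s k = f k &
                exists2 B, 0 <= B & forall k, `|s k| <= B].
Proof.
move=> fN f0; exists (fun k => \sum_(0 <= i < k) f i).
have sN := partial_sum_periodic fN f0; split=> //.
  by move=> k; rewrite big_nat_recr//= addrAC subrr add0r.
exact: periodic_bounded.
Qed.

End periodic_sequences.

(** * Weights of ratio less than the mean, and supersolutions below the maximum *)

Lemma mulr_expR1B_le1 (R : realType) (x : R) : x * expR (1 - x) <= 1.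
Proof.
rewrite -opprB expRN -ler_pdivlMr ?invr_gt0 ?expR_gt0// div1r invrK.
by have := expR_ge1Dx (x - 1); rewrite addrC subrK.
Qed.

Lemma mulr_expR1B_lt1 (R : realType) (x : R) : x != 1 -> x * expR (1 - x) < 1.
Proof.
move=> x1; rewrite -opprB expRN -ltr_pdivlMr ?invr_gt0 ?expR_gt0// div1r invrK.
by have := @expR_gt1Dx R (x - 1); rewrite subr_eq0 addrC subrK; apply.
Qed.

Section weights.
Variables (R : realType) (N : nat) (alpha : nat -> R).
Hypothesis N_gt0 : (0 < N)%N.
Hypothesis alpha_ge0 : forall k, 0 <= alpha k.
Hypothesis alphaN : forall k, alpha (k + N)%N = alpha k.

(** With [t k := alpha k / A], of mean [1], the weights with increments
    [1 - t k] already give the ratios [A * phi k], where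
    [phi k := t k * exp (1 - t k) <= 1], and [phi k < 1] for some [k].  To gain
    uniformly in [k], the same step is repeated on [phi]: the further increments
    [(1 - phi k) - gbar], where [gbar > 0] is the mean of [1 - phi], spread the
    gain over the period and give the ratio [A * exp (- gbar)]. *)
Lemma lt_mean_weights : (exists i j : 'I_N, alpha i <> alpha j) ->
  exists rho s, [/\ 0 < rho, rho < mean N alpha,
    forall k, alpha k * expR (s k.+1) <= rho * expR (s k) &
    exists2 B, 0 <= B & forall k, `|s k| <= B].
Proof.
move=> [i [j aij]]; pose A := mean N alpha.
have [m am] : exists m : 'I_N, alpha m != A.
  have [ai|ai] := eqVneq (alpha i) A; last by exists i.
  by exists j; apply/eqP => aj; apply: aij; rewrite ai aj.
have A0 : 0 < A.
  apply: mean_gt0 => //; have := alpha_ge0 i; rewrite le_eqVlt => /predU1P[ai|ai].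
    exists j; rewrite lt_def alpha_ge0 andbT.
    by apply/eqP => aj; apply: aij; rewrite -ai aj.
  by exists i.
pose t k := A^-1 * alpha k; pose phi k := t k * expR (1 - t k).
pose gbar := mean N (fun k => 1 - phi k).
have phi1 k : phi k <= 1 by exact: mulr_expR1B_le1.
have gbar0 : 0 < gbar.
  apply: mean_gt0 => //; first by move=> k; rewrite subr_ge0.
  exists m; rewrite subr_gt0 mulr_expR1B_lt1//.
  apply: contra am => /eqP tm.
  by rewrite -(mulVKf (lt0r_neq0 A0) (alpha m)) -/(t m) tm mulr1.
pose delta k := (1 - t k) - (gbar - (1 - phi k)).
have deltaN k : delta (k + N)%N = delta k by rewrite /delta /phi /t alphaN.
have delta0 : mean N delta = 0.
  rewrite (meanB N (fun k => 1 - t k) (fun k => gbar - (1 - phi k))).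
  rewrite (meanB N (fun=> 1)) (meanB N (fun=> gbar)) !mean_cst// meanZ.
  by rewrite mulVf ?lt0r_neq0// !subrr.
have [s [_ sE sB]] := periodic_primitive N_gt0 deltaN delta0.
exists (A * expR (- gbar)), s; split=> //.
- by rewrite mulr_gt0// expR_gt0.
- by rewrite -/A gtr_pMr// -[ltRHS]expR0 ltr_expR oppr_lt0.
move=> k; rewrite -[s k.+1](subrK (s k)) sE expRD mulrA ler_wpM2r ?expR_ge0//.
have -> : alpha k * expR (delta k) = A * expR (- gbar) * (phi k * expR (1 - phi k)).
  have -> : delta k = (1 - t k) + - gbar + (1 - phi k) by rewrite /delta; ring.
  have {1}-> : alpha k = A * t k by rewrite /t mulVKf ?lt0r_neq0.
  rewrite (expRD (1 - t k + - gbar)) (expRD (1 - t k)).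
  by rewrite -[X in _ = _ * (X * _)]/(t k * expR (1 - t k)); ring.
by rewrite ler_piMr ?mulr_expR1B_le1// mulr_ge0 ?expR_ge0// ltW.
Qed.

(** Put [beta k := M - alpha k], of mean [bbar > 0].  The periodic sequence [q],
    nonnegative after adding a constant, solves
    [M * (q (k+2) - 2 q (k+1) + q k) = beta (k+1) + beta k - 2 bbar].  Then
    [v := 1 + q] satisfies the inequality with [2 * M * v (k+1) - 2 * bbar] on
    the right, and boundedness of [v] turns the constant gain [bbar] into a
    multiplicative one.  The separate inequality at the left end reflects that
    the shift is unilateral. *)
Lemma lt_max_supersolution (M : R) : (forall k, alpha k <= M) ->
  (exists i : 'I_N, alpha i < M) ->
  exists lambda v, [/\ lambda < M, forall k, 0 < v k,
    alpha 0%N * v 1%N <= 2 * lambda * v 0%N &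
    forall k, alpha k * v k + alpha k.+1 * v k.+2 <= 2 * lambda * v k.+1].
Proof.
move=> aM [i ai].
have M0 : 0 < M by exact: le_lt_trans (alpha_ge0 i) ai.
pose beta k := M - alpha k; pose bbar := mean N beta.
have beta0 k : 0 <= beta k by rewrite subr_ge0.
have bbar0 : 0 < bbar by apply: mean_gt0 => //; exists i; rewrite subr_gt0.
pose f k := beta k - bbar.
have fN k : f (k + N)%N = f k by rewrite /f /beta alphaN.
have f0 : mean N f = 0 by rewrite meanB mean_cst// subrr.
have [F [FN FE _]] := periodic_primitive N_gt0 fN f0.
(* Adding two neighbouring values of [F] makes the increment of [d], which is the
   second difference of [p], symmetric in the two weights next to a site. *)
pose c := mean N (fun k => F k.+1 + F k).
pose d k := M^-1 * (F k.+1 + F k - c).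
have dN k : d (k + N)%N = d k by rewrite /d -addSn !FN.
have d0 : mean N d = 0 by rewrite meanZ meanB mean_cst// subrr mulr0.
have [p [pN pE [B B0 pB]]] := periodic_primitive N_gt0 dN d0.
pose q k := p k + B.
have q0 k : 0 <= q k.
  by have := pB k; rewrite ler_norml /q => /andP[+ _]; lra.
have qB k : q k <= 2 * B.
  by have := pB k; rewrite ler_norml /q => /andP[_ +]; lra.
pose lambda := M - bbar / (1 + 2 * B).
have B1 : 0 < 1 + 2 * B by lra.
have qE k : M * (q k.+2 + q k - 2 * q k.+1) = beta k.+1 + beta k - 2 * bbar.
  have -> : q k.+2 + q k - 2 * q k.+1 = d k.+1 - d k by rewrite -!pE /q; ring.
  rewrite /d -mulrBr mulVKf ?lt0r_neq0//.
  have := FE k; have := FE k.+1; rewrite /f; lra.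
have vE k : alpha k * (1 + q k) + alpha k.+1 * (1 + q k.+2) <=
    2 * lambda * (1 + q k.+1).
  have h : bbar / (1 + 2 * B) * (1 + q k.+1) <= bbar.
    rewrite mulrAC ler_pdivrMr// ler_pM2l//.
    by rewrite lerD2l.
  have -> : 2 * lambda * (1 + q k.+1) =
      2 * M * (1 + q k.+1) - 2 * (bbar / (1 + 2 * B) * (1 + q k.+1)).
    by rewrite /lambda; ring.
  have := qE k; have := mulr_ge0 (beta0 k) (q0 k).
  have := mulr_ge0 (beta0 k.+1) (q0 k.+2).
  rewrite /beta; nra.
exists lambda, (fun k => 1 + q k); split=> //.
- by rewrite /lambda ltrBlDr ltrDl divr_gt0.
- by move=> k; have := q0 k; lra.
have qN k : q (k + N)%N = q k by rewrite /q pN.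
(* The left end is the inequality at the end of a period, less one term. *)
have := vE N.-1; rewrite prednK// -[N]add0n alphaN -addSn !qN add0n.
have := mulr_ge0 (alpha_ge0 N.-1) (q0 N.-1); have := alpha_ge0 N.-1.
by nra.
Qed.

End weights.

(** * Two square-sum estimates *)

(** The Schur test for a tridiagonal form: each product [u k * u (k+1)] is split
    by the inequality of the means with ratio [v (k+1) / v k], and the
    supersolution inequality collects the two shares of [u k ^ 2]. *)
Lemma schur_test (R : realFieldType) (lambda : R) (alpha v u : nat -> R) n :
  (forall k, 0 <= alpha k) -> (forall k, 0 < v k) ->
  alpha 0%N * v 1%N <= 2 * lambda * v 0%N ->
  (forall k, alpha k * v k + alpha k.+1 * v k.+2 <= 2 * lambda * v k.+1) ->
  \sum_(0 <= k < n) alpha k * (u k * u k.+1) <= lambda * \sum_(0 <= k < n.+1) u k ^+ 2.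
Proof.
move=> a0 v0 v1 vS.
(* The share of [u n ^ 2] left over once the products up to [n] are paid for. *)
pose theta k := 2 * lambda - alpha k * v k.+1 / v k.
suff H : 2 * \sum_(0 <= k < n) alpha k * (u k * u k.+1) <=
   2 * lambda * \sum_(0 <= k < n) u k ^+ 2 + theta n * u n ^+ 2.
  have : 0 <= alpha n * v n.+1 / v n * u n ^+ 2.
    by rewrite mulr_ge0 ?sqr_ge0// divr_ge0 ?mulr_ge0 ?(ltW (v0 _)).
  move: H; rewrite big_nat_recr//= /theta.
  set S1 := \sum_(_ <= _ < _) _; set S2 := \sum_(_ <= _ < _) _.
  by set c := alpha n * _ / _; lra.
elim: n => [|n IH].
  rewrite !big_geq// !mulr0 add0r mulr_ge0 ?sqr_ge0// subr_ge0.
  by rewrite ler_pdivrMr.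
have st : alpha n * v n / v n.+1 <= theta n.+1.
  rewrite /theta -[2 * lambda](@mulfK _ (v n.+1)) ?lt0r_neq0//.
  by rewrite -mulrBl ler_pM2r ?invr_gt0//; have := vS n; lra.
have amgm : 2 * (alpha n * (u n * u n.+1)) <=
    alpha n * v n.+1 / v n * u n ^+ 2 + alpha n * v n / v n.+1 * u n.+1 ^+ 2.
  rewrite -subr_ge0.
  have n0 k : v k != 0 by rewrite lt0r_neq0.
  rewrite (_ : _ - _ = alpha n * (v n.+1 * u n - v n * u n.+1) ^+ 2 / (v n * v n.+1)).
    by apply: divr_ge0; apply: mulr_ge0; rewrite ?sqr_ge0 ?(ltW (v0 _)).
  by field; rewrite !n0.
have := ler_wpM2r (sqr_ge0 (u n.+1)) st.
rewrite !big_nat_recr//= !mulrDr; move: IH amgm; rewrite /theta.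
set S1 := \sum_(_ <= _ < _) _; set S2 := \sum_(_ <= _ < _) _.
lra.
Qed.

(** A discrete Young inequality: [u] is dominated by the convolution of [v] with
    the geometric sequence of ratio [q], whose sum is [1 / (1 - q)]. *)
Lemma contraction_sum_sqr (R : realFieldType) (q : R) (u v : nat -> R) n : 0 <= q < 1 ->
  (forall k, 0 <= u k) -> u 0%N <= v 0%N ->
  (forall k, u k.+1 <= q * u k + v k.+1) ->
  (1 - q) ^+ 2 * \sum_(0 <= k < n) u k ^+ 2 <= \sum_(0 <= k < n) v k ^+ 2.
Proof.
move=> /andP[q0 q1] u0 u0v uS.
suff H m : (1 - q) ^+ 2 * \sum_(0 <= k < m.+1) u k ^+ 2 + (1 - q) * q * u m ^+ 2
    <= \sum_(0 <= k < m.+1) v k ^+ 2.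
  case: n => [|n]; first by rewrite !big_geq// mulr0.
  by apply: le_trans (H n); rewrite lerDl !mulr_ge0 ?sqr_ge0// subr_ge0 ltW.
have sq (x y : R) : 0 <= x -> x <= y -> x ^+ 2 <= y ^+ 2.
  by move=> x0 xy; rewrite ler_pXn2r// nnegrE (le_trans x0).
elim: m => [|m IH].
  by rewrite !big_nat1; have := sq _ _ (u0 0%N) u0v; have := sqr_ge0 (u 0%N); nra.
rewrite big_nat_recr//= [leRHS]big_nat_recr//=.
have uv : (1 - q) * u m.+1 ^+ 2 <= (1 - q) * q * u m ^+ 2 + v m.+1 ^+ 2.
  have := ler_wpM2l (_ : 0 <= 1 - q) (sq _ _ (u0 m.+1) (uS m)).
  rewrite subr_ge0 ltW// => /(_ isT)/le_trans; apply.
  rewrite -subr_ge0 (_ : _ - _ = q * ((1 - q) * u m - v m.+1) ^+ 2); last by ring.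
  by rewrite mulr_ge0 ?sqr_ge0.
move: IH uv; set S1 := \sum_(_ <= _ < _) _; set S2 := \sum_(_ <= _ < _) _.
by lra.
Qed.

(** * Norms and inner products in the sequence space *)

Section hilbert.
Import ComplexField.Normc.
Variable R : realType.
Implicit Types (x y : ell2 R).
Local Notation hnorm := (hnorm (@ell2_dot R)).

Lemma hnorm_ge0 x : 0 <= hnorm x.
Proof. exact: sqrtr_ge0. Qed.

Lemma hnorm_sqr x : hnorm x ^+ 2 = limn (series (fun k => normc (x k) ^+ 2)).
Proof.
rewrite sqr_sqrtr -[X in complex.Re X]/(ell2_dot x x) ell2_dotxx//=.
apply: limr_ge; first exact: ell2P.
by apply: nearW => n; apply: sumr_ge0 => k _; exact: sqr_ge0.
Qed.

Lemma partial_sum_le_hnorm x n :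
  \sum_(0 <= k < n) normc (x k) ^+ 2 <= hnorm x ^+ 2.
Proof.
rewrite hnorm_sqr.
apply: (@nondecreasing_cvgn_le _ (series (fun k => normc (x k) ^+ 2))).
  by apply: nondecreasing_series => j _ _; exact: sqr_ge0.
exact: ell2P.
Qed.

Lemma hnorm_le x C : 0 <= C ->
  (forall n, \sum_(0 <= k < n) normc (x k) ^+ 2 <= C ^+ 2) -> hnorm x <= C.
Proof.
move=> C0 xC; rewrite -(@ler_pXn2r _ 2) ?nnegrE ?hnorm_ge0// hnorm_sqr.
by apply: limr_le; [exact: ell2P|exact: nearW].
Qed.

Lemma normc_le_hnorm x k : normc (x k) <= hnorm x.
Proof.
rewrite -(@ler_pXn2r _ 2) ?nnegrE ?hnorm_ge0 ?normc_ge0//.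
apply: le_trans (partial_sum_le_hnorm x k.+1); rewrite big_nat_recr//= lerDr.
by apply: sumr_ge0 => i _; exact: sqr_ge0.
Qed.

Lemma square_summable_bounded (f : nat -> R[i]) C :
  (forall n, \sum_(0 <= k < n) normc (f k) ^+ 2 <= C) ->
  f \in @square_summable R.
Proof.
move=> fC; apply/asboolP/nondecreasing_is_cvgn.
  by apply: nondecreasing_series => j _ _; exact: sqr_ge0.
by exists C => _ [n _ <-]; exact: fC.
Qed.

Lemma sum_eventually0 (V : nmodType) (F : nat -> V) n m : (n <= m)%N ->
  (forall k, (n <= k)%N -> F k = 0) ->
  \sum_(0 <= k < m) F k = \sum_(0 <= k < n) F k.
Proof.
move=> nm F0; rewrite (@big_cat_nat _ _ _ n)//= [X in _ + X](_ : _ = 0) ?addr0//.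
by rewrite big_nat_cond big1// => k; rewrite andbT => /andP[/F0].
Qed.

Lemma truncation_subproof (f : nat -> R[i]) n :
  (fun k => if (k < n)%N then f k else 0) \in @square_summable R.
Proof.
set g := fun k => _.
apply: (@square_summable_bounded _ (\sum_(0 <= k < n) normc (g k) ^+ 2)) => m.
rewrite -(@sum_eventually0 _ (fun k => normc (g k) ^+ 2) n (m + n)) ?leq_addl//.
  rewrite [leRHS](@big_cat_nat _ _ _ m) ?leq_addr//= lerDl.
  by apply: sumr_ge0 => k _; exact: sqr_ge0.
by move=> k nk; rewrite /g ifN -?leqNgt// normc0 expr0n.
Qed.

Definition truncation f n : ell2 R := Ell2 (truncation_subproof f n).

Lemma hnorm_truncation f n :
  hnorm (truncation f n) ^+ 2 = \sum_(0 <= k < n) normc (f k) ^+ 2.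
Proof.
rewrite hnorm_sqr; apply: cvg_lim => //; apply: cvg_near_cst; near=> m.
have nm : (n <= m)%N by near: m; exact: nbhs_infty_ge.
rewrite /series/= (@sum_eventually0 _ _ n m)//.
  by apply: eq_big_nat => k /andP[_ ->].
by move=> k nk; rewrite ifN -?leqNgt// normc0 expr0n.
Unshelve. all: by end_near. Qed.

Variable a : ellinf R.

Lemma ell2_dot_wshift_cvg x :
  (series (fun k => a k * x k * (x k.+1)^*%R : R[i]^o) @ \oo -->
    (ell2_dot (wshift a x) x : R[i]^o))%classic.
Proof.
have := @ell2_dot_cvg _ (wshift a x) x; rewrite -cvg_shiftS.
rewrite (_ : [sequence _]_n = series (fun k => a k * x k * (x k.+1)^*%R : R[i]^o))//.
apply/funext => n; rewrite /series/= big_nat_recl//= mul0r add0r.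
by [].
Qed.

Lemma normc_le_lim (u : nat -> R[i]^o) (l : R[i]^o) C :
  (u @ \oo --> l)%classic -> (forall n, normc (u n) <= C) -> normc l <= C.
Proof.
move=> ul uC; apply/ler_addgt0Pr => e e0.
have /cvgrPdist_lt/(_ e%:C%C) := ul; rewrite ltcR => /(_ e0)/filter_ex[n].
rewrite normrE_normc ltcR => lu; rewrite -[l](subrK (u n)) addrC.
by apply: le_trans (le_normcD _ _) _; rewrite lerD ?uC ?ltW.
Qed.

(** Only the moduli of the coordinates matter for an upper bound, so that the
    numerical radius reduces to estimates on real tridiagonal forms. *)
Lemma numerical_range_bound lambda x :
  (forall n, \sum_(0 <= k < n) normc (a k) * (normc (x k) * normc (x k.+1)) <=
     lambda * \sum_(0 <= k < n.+1) normc (x k) ^+ 2) ->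
  0 <= lambda -> hnorm x = 1 ->
  normc (ell2_dot (wshift a x) x) <= lambda.
Proof.
move=> xl l0 x1; apply: (normc_le_lim (@ell2_dot_wshift_cvg x)) => n.
have := ler_wpM2l l0 (partial_sum_le_hnorm x n.+1).
rewrite x1 expr1n mulr1; apply: le_trans; apply: le_trans (xl n).
rewrite /series/=; elim: n => [|n IH]; first by rewrite !big_geq// normc0.
rewrite !big_nat_recr//=; apply: le_trans (le_normcD _ _) _.
by rewrite lerD// !normcM normc_conj mulrA.
Qed.

End hilbert.

(** * The resolvent outside a disc *)

Section resolvent.
Import ComplexField.Normc.
Variables (R : realType) (a : ellinf R) (z : R[i]).
Implicit Types (x y : ell2 R).

(** The coordinates of the only solution [x] of [(T - z) x = y]: as [T] shifts
    forward, the [k]-th equation gives [x k] from [x (k-1)]. *)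
Fixpoint resolvent_seq (y : nat -> R[i]) k : R[i] :=
  if k is j.+1 then (a j * resolvent_seq y j - y j.+1) / z else - y 0%N / z.

Variables (rho B : R) (s : nat -> R).
Hypothesis rho_gt0 : 0 < rho.
Hypothesis rho_z : rho < normc z.
Hypothesis as_rho : forall k, normc (a k) * expR (s k.+1) <= rho * expR (s k).
Hypothesis sB : forall k, `|s k| <= B.

Let C := expR (2 * B) / (normc z - rho).

Let z_gt0 : 0 < normc z. Proof. exact: lt_trans rho_z. Qed.

Let z_neq0 : z != 0.
Proof. by apply/eqP => z0; move: z_gt0; rewrite z0 normc0 ltxx. Qed.

Let C_ge0 : 0 <= C.
Proof. by rewrite divr_ge0 ?expR_ge0// subr_ge0 ltW. Qed.

(** After weighting by [exp (s k)], the recursion is a contraction of ratio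
    [rho / |z|]; removing the weights costs a factor [exp (2 * B)]. *)
Lemma resolvent_seq_le (y : nat -> R[i]) n :
  \sum_(0 <= k < n) normc (resolvent_seq y k) ^+ 2 <=
  C ^+ 2 * \sum_(0 <= k < n) normc (y k) ^+ 2.
Proof.
pose x := resolvent_seq y.
pose u k := expR (s k) * normc (x k).
pose v k := expR (s k) * normc (y k) / normc z.
pose q := rho / normc z.
have q01 : 0 <= q < 1.
  by rewrite divr_ge0 ?(ltW rho_gt0) ?(ltW z_gt0)// ltr_pdivrMr// mul1r.
have u0 k : 0 <= u k by rewrite mulr_ge0 ?expR_ge0 ?normc_ge0.
have := @contraction_sum_sqr _ q u v n q01 u0.
have -> : u 0%N <= v 0%N by rewrite /u /v /= normcM normcV normcN mulrA.
move=> /(_ isT) uv.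
have {}uv : (1 - q) ^+ 2 * \sum_(0 <= k < n) u k ^+ 2 <= \sum_(0 <= k < n) v k ^+ 2.
  apply: uv => k.
  have -> : q * u k + v k.+1 =
      (rho * expR (s k) * normc (x k) + expR (s k.+1) * normc (y k.+1)) / normc z.
    by rewrite /q /u /v; ring.
  rewrite /u /= normcM normcV mulrA ler_pM2r ?invr_gt0//.
  apply: le_trans (_ : expR (s k.+1) * (normc (a k * x k) + normc (y k.+1)) <= _).
    by rewrite ler_wpM2l ?expR_ge0// -(normcN (y k.+1)) le_normcD.
  rewrite mulrDr lerD2r normcM mulrCA mulrA.
  by rewrite ler_wpM2r ?normc_ge0// as_rho.
have eB k : expR (- B) <= expR (s k) <= expR B.
  by rewrite !ler_expR -ler_norml.
have ux k : expR (- B) ^+ 2 * normc (x k) ^+ 2 <= u k ^+ 2.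
  rewrite -exprMn ler_pXn2r ?nnegrE ?mulr_ge0 ?expR_ge0 ?normc_ge0//.
  by rewrite ler_wpM2r ?normc_ge0//; case/andP: (eB k).
have vy k : v k ^+ 2 <= (expR B / normc z) ^+ 2 * normc (y k) ^+ 2.
  rewrite -exprMn ler_pXn2r//;
    rewrite ?nnegrE ?mulr_ge0 ?expR_ge0 ?invr_ge0 ?normc_ge0//.
  rewrite /v mulrAC ler_wpM2r ?normc_ge0// ler_wpM2r ?invr_ge0 ?normc_ge0//.
  by case/andP: (eB k).
have ux_sum : expR (- B) ^+ 2 * \sum_(0 <= k < n) normc (x k) ^+ 2 <=
    \sum_(0 <= k < n) u k ^+ 2.
  by rewrite mulr_sumr; apply: ler_sum => k _; exact: ux.
have vy_sum : \sum_(0 <= k < n) v k ^+ 2 <=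
    (expR B / normc z) ^+ 2 * \sum_(0 <= k < n) normc (y k) ^+ 2.
  by rewrite mulr_sumr; apply: ler_sum => k _; exact: vy.
have q1 : 0 < 1 - q by rewrite subr_gt0; case/andP: q01.
have D0 : 0 < ((1 - q) * expR (- B)) ^+ 2 by rewrite exprn_gt0// mulr_gt0// expR_gt0.
rewrite -(ler_pM2l D0).
have -> : ((1 - q) * expR (- B)) ^+ 2 * (C ^+ 2 * \sum_(0 <= k < n) normc (y k) ^+ 2) =
    (expR B / normc z) ^+ 2 * \sum_(0 <= k < n) normc (y k) ^+ 2.
  rewrite mulrA -exprMn; congr (_ ^+ 2 * _); rewrite /C /q.
  have -> : 2 * B = B + B by ring.
  rewrite expRD expRN; field; rewrite !gt_eqF ?expR_gt0//.
  by rewrite subr_gt0.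
apply: le_trans vy_sum; apply: le_trans uv.
by rewrite exprMn -mulrA ler_wpM2l ?sqr_ge0.
Qed.

Lemma resolvent_subproof y : resolvent_seq y \in @square_summable R.
Proof.
apply: (@square_summable_bounded _ _ (C ^+ 2 * hnorm (@ell2_dot R) y ^+ 2)) => n.
apply: le_trans (resolvent_seq_le y n) _.
by rewrite ler_wpM2l ?sqr_ge0// partial_sum_le_hnorm.
Qed.

Definition resolvent y : ell2 R := Ell2 (resolvent_subproof y).

Lemma resolvent_linear : linear resolvent.
Proof.
move=> c x y; apply/val_inj/funext => k /=.
rewrite -[RHS]/(c * resolvent_seq x k + resolvent_seq y k).
elim: k => [|k IH] /=.
  by rewrite [X in - X / z = _](_ : _ = c * x 0%N + y 0%N)//; ring.
by rewrite IH [X in (_ - X) / z = _](_ : _ = c * x k.+1 + y k.+1)//; ring.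
Qed.

Lemma resolvent_bounded : bounded_op (@ell2_dot R) resolvent.
Proof.
split; first exact: resolvent_linear.
exists C => y; apply: hnorm_le; first by rewrite mulr_ge0 ?hnorm_ge0.
move=> n; apply: le_trans (resolvent_seq_le y n) _.
by rewrite [leRHS]exprMn ler_wpM2l ?sqr_ge0// partial_sum_le_hnorm.
Qed.

Let wshift_subE x k : (wshift a x - z *: x : ell2 R) k = wshift_seq a x k - z * x k.
Proof. by []. Qed.

Lemma resolventK : cancel resolvent (fun x => wshift a x - z *: x).
Proof.
move=> y; apply/val_inj/funext => -[|k]; rewrite [LHS]wshift_subE /=.
  by field.
by field.
Qed.

Lemma wshift_subK : cancel (fun x => wshift a x - z *: x) resolvent.
Proof.
move=> x; apply/val_inj/funext.
suff H (y : ell2 R) : (forall k, y k = wshift_seq a x k - z * x k) ->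
  forall k, resolvent_seq y k = x k by exact: H.
by move=> yE; elim=> [|k IH]; rewrite /= ?IH yE /=; field.
Qed.

Lemma notin_spectrum : ~ spectrum (@ell2_dot R) (wshift a) z.
Proof.
apply; exists resolvent; split; [exact: resolvent_bounded|exact: wshift_subK|].
exact: resolventK.
Qed.

End resolvent.

(** * Lower bounds for the numerical radius and the norm *)

Section lower_bounds.
Import ComplexField.Normc.
Variables (R : realType) (a : ellinf R).
Local Notation hnorm := (hnorm (@ell2_dot R)).

(** At [0] any value of modulus one will do; the quotient would give [0]. *)
Definition phase (c : R[i]) : R[i] := if c == 0 then 1 else c / `|c|.

Lemma normc_phase c : normc (phase c) = 1.
Proof.
rewrite /phase; case: eqVneq => [_|c0]; first exact: normc1.
rewrite normcM normcV normrE_normc /= expr0n addr0 sqrtr_sqr.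
rewrite ger0_norm ?normc_ge0// divff//.
by apply: contra c0 => /eqP/eq0_normc ->.
Qed.

Lemma mul_conj_phase c : c * (phase c)^*%R = `|c|.
Proof.
rewrite /phase; case: eqVneq => [->|c0]; first by rewrite mul0r normr0.
rewrite rmorphM/= fmorphV/= mulrA -normCK.
have -> : (`|c|^*)%R = `|c| by apply: CrealP; exact: normr_real.
by rewrite expr2 mulfK ?normr_eq0.
Qed.

(** Chosen so that the [k]-th product in [<T x, x>] is [|a k|]. *)
Fixpoint aligned_phase k : R[i] :=
  if k is j.+1 then aligned_phase j * phase (a j) else 1.

Lemma normc_aligned_phase k : normc (aligned_phase k) = 1.
Proof.
elim: k => [|k IH]; first exact: normc1.
rewrite [aligned_phase _]/(aligned_phase k * phase (a k)).
by rewrite normcM IH normc_phase mulr1.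
Qed.

Lemma aligned_phaseE k :
  a k * aligned_phase k * (aligned_phase k.+1)^*%R = (normc (a k))%:C%C.
Proof.
rewrite [aligned_phase k.+1]/(aligned_phase k * phase (a k)) rmorphM.
rewrite [LHS](_ : _ = (aligned_phase k * (aligned_phase k)^*%R) *
                      (a k * (phase (a k))^*%R)).
  rewrite -normCK normrE_normc normc_aligned_phase expr1n mul1r.
  by rewrite mul_conj_phase normrE_normc.
by move=> /=; ring.
Qed.

(** The test vector has [m+1] coordinates of equal modulus; its last coordinate
    is shifted out of its support, hence only [m] weights appear. *)
Lemma numerical_range_flat m :
  numerical_range (@ell2_dot R) (wshift a)
    (m.+1%:R^-1 * \sum_(0 <= k < m) normc (a k))%:C%C.
Proof.
pose c : R := (Num.sqrt m.+1%:R)^-1.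
have c2 : c ^+ 2 = m.+1%:R^-1 by rewrite exprVn sqr_sqrtr.
pose f k := c%:C%C * aligned_phase k.
pose x := truncation f m.+1.
have fE k : normc (f k) ^+ 2 = m.+1%:R^-1.
  rewrite normcM normc_aligned_phase mulr1 /= expr0n addr0 sqrtr_sqr.
  by rewrite real_normK ?num_real.
exists x.
  apply/eqP; rewrite -(@eqrXn2 _ 2) ?hnorm_ge0//.
  rewrite hnorm_truncation expr1n (eq_bigr (fun=> m.+1%:R^-1)); last first.
    by move=> k _; exact: fE.
  by rewrite big_mkord sumr_const card_ord -[_ *+ _]mulr_natl divff// pnatr_eq0.
rewrite -[LHS]/(ell2_dot (wshift a x) x).
apply: (@norm_cvg_unique _ R[i]^o _ _ _ _ (@ell2_dot_wshift_cvg _ a x)).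
apply: cvg_near_cst; near=> n.
have mn : (m <= n)%N by near: n; exact: nbhs_infty_ge.
rewrite /series/= (@sum_eventually0 _ _ m n)//; last first.
  by move=> k mk; rewrite [if (k.+1 < _)%N then _ else _]ifN -?leqNgt// rmorph0 mulr0.
rewrite rmorphM rmorph_sum/= mulr_sumr; apply: eq_big_nat => k /andP[_ km].
rewrite ltnS (ltnW km) ltnS km.
have -> : (m.+1%:R^-1)%:C%C = c%:C%C * (c%:C%C)^*%R.
  by rewrite conjCE conjc_real -rmorphM/= -expr2 c2.
by rewrite /f rmorphM -aligned_phaseE; ring.
Unshelve. all: by end_near. Qed.

Lemma numerical_radius_flat m :
  has_ubound [set normc z | z in numerical_range (@ell2_dot R) (wshift a)]%classic ->
  m.+1%:R^-1 * \sum_(0 <= k < m) normc (a k) <= wnorm a.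
Proof.
move=> ub; apply: ub_le_sup => //.
exists (m.+1%:R^-1 * \sum_(0 <= k < m) normc (a k))%:C%C.
  exact: numerical_range_flat.
rewrite /= expr0n addr0 sqrtr_sqr ger0_norm// mulr_ge0 ?invr_ge0//.
by apply: sumr_ge0 => k _; exact: normc_ge0.
Qed.

(** Tested on the [k]-th basis vector. *)
Lemma op_norm_ge_weight k : normc (a k) <= op_norm (@ell2_dot R) (wshift a).
Proof.
pose e : ell2 R := truncation (fun j => (j == k)%:R) k.+1.
have e1 : hnorm e <= 1.
  rewrite -(@ler_pXn2r _ 2) ?nnegrE ?hnorm_ge0// hnorm_truncation expr1n.
  rewrite big_nat_recr//= eqxx big_nat_cond big1 ?add0r.
    by rewrite normc1 expr1n.
  by move=> j; rewrite andbT => /andP[_ jk]; rewrite ltn_eqF// mulr0n normc0 expr0n.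
apply: (@le_trans _ _ (hnorm (wshift a e))).
  apply: le_trans (normc_le_hnorm _ k.+1).
  by rewrite /= ltnSn eqxx mulr1.
apply: ub_le_sup; last by exists e.
have [_ [C aC]] := wshift_bounded a; exists (Num.max C 0) => _ [x x1 <-].
apply: le_trans (aC x) _; apply: le_trans (_ : Num.max C 0 * hnorm x <= _).
  by rewrite ler_wpM2r ?hnorm_ge0// le_max lexx.
by rewrite ler_piMr// le_max lexx orbT.
Qed.

End lower_bounds.

(** * Convexoid operators *)

(** A disc is convex, so it contains the convex hull of the spectrum as soon as
    it contains the spectrum. *)
Lemma convexoid_bound (R : realType) (V : lmodType R[i])
    (dot : {dot V for @Num.conj R[i]}) (T : V -> V) rho z :
  (forall z, spectrum dot T z -> normc z <= rho) ->
  convexoid dot T ->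
  numerical_range dot T z -> normc z <= rho.
Proof.
move=> sp cvx Wz.
have : (convex_hull (spectrum dot T)) z.
  by rewrite -cvx; exact: subset_closure.
apply: (@smallest_sub _ _ _ [set z | normc z <= rho]%classic) => //.
move=> x y t; rewrite !inE /= -!lecR -!normrE_normc => xr yr.
suff H (p : R[i]) : 0 <= p -> 0 <= 1 - p ->
    `|p * (x : R[i]) + (1 - p) * (y : R[i])| <= rho%:C%C.
  by apply: (H t%:num); rewrite ?subr_ge0.
move=> p0 p1; rewrite -[leRHS]mul1r -[X in _ <= X * _](subrKC p) [leRHS]mulrDl.
apply: le_trans (ler_normD _ _) _.
by rewrite !normrM (ger0_norm p0) (ger0_norm p1) lerD// ler_wpM2l.
Qed.

(** * The spectral radius, the mean and the numerical radius *)

Theorem corollary2p12 (R : realType) (a : ellinf R) (N : nat)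
  (N_gt0 : (0 < N)%N) (a_periodic : forall k, a (k + N)%N = a k)
  (a_nonconst : exists i j : 'I_N, i != j /\ normc (a i) <> normc (a j)) :
  [/\ spectral_radius (@ell2_dot R) (wshift a)
        < N%:R^-1 * \sum_(k < N) normc (a k),
      N%:R^-1 * \sum_(k < N) normc (a k) <= wnorm a,
      wnorm a < \big[Num.max/0]_(k < N) normc (a k),
      ~ normaloid (@ell2_dot R) (wshift a) &
      ~ convexoid (@ell2_dot R) (wshift a)].
Proof.
pose alpha k := normc (a k).
have alpha_ge0 k : 0 <= alpha k by exact: normc_ge0.
have alphaN k : alpha (k + N)%N = alpha k by rewrite /alpha a_periodic.
have [i [j [_ aij]]] := a_nonconst.
set A := N%:R^-1 * _; set M := \big[_/_]_(_ < _) _.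
have alphaM k : alpha k <= M.
  rewrite (periodic_modn _ alphaN).
  exact: (le_bigmax 0 (fun k : 'I_N => alpha k) (Ordinal (ltn_pmod k N_gt0))).
have [rho [s [rho0 rhoA as_rho [B _ sB]]]] :=
  lt_mean_weights N_gt0 alpha_ge0 alphaN (ex_intro _ i (ex_intro _ j aij)).
have sp z : spectrum (@ell2_dot R) (wshift a) z -> normc z <= rho.
  by move=> zsp; rewrite leNgt; apply/negP => /notin_spectrum/(_ as_rho sB); apply.
have some_lt_M : exists l : 'I_N, alpha l < M.
  have := alphaM i; rewrite le_eqVlt => /predU1P[iM|]; last by exists i.
  exists j; rewrite lt_neqAle alphaM andbT; apply/eqP => jM; apply: aij.
  by rewrite -/(alpha i) iM -jM.
have [lambda [v [lambdaM v0 v1 vS]]] :=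
  lt_max_supersolution N_gt0 alpha_ge0 alphaN alphaM some_lt_M.
have lambda0 : 0 <= lambda.
  have : 0 <= 2 * lambda * v 0%N by apply: le_trans v1; rewrite mulr_ge0// ltW.
  by rewrite pmulr_lge0// pmulr_rge0.
have Wle z : numerical_range (@ell2_dot R) (wshift a) z -> normc z <= lambda.
  case=> x x1 <-; apply: numerical_range_bound => // n.
  exact: (schur_test (fun k => normc (x k))).
have W_ub :
    has_ubound [set normc z | z in numerical_range (@ell2_dot R) (wshift a)]%classic.
  by exists lambda => _ [z Wz <-]; exact: Wle.
have w_lt_M : wnorm a < M.
  apply: le_lt_trans lambdaM; apply: ge_sup => [|_ [z Wz <-]]; last exact: Wle.
  by eexists; eexists; [exact: (@numerical_range_flat _ a 0)|].
have A_le_w : A <= wnorm a.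
  (* The sum of [m] weights is [m * A] up to a bounded error [2 * C]. *)
  have fN k : alpha (k + N)%N - A = alpha k - A by rewrite alphaN.
  have f0 : mean N (fun k => alpha k - A) = 0 by rewrite meanB mean_cst// subrr.
  have [S [_ SE [C C0 SC]]] := periodic_primitive N_gt0 fN f0.
  have sumS m : \sum_(0 <= k < m) alpha k = m%:R * A + (S m - S 0%N).
    elim: m => [|m IH]; first by rewrite big_geq// mul0r subrr addr0.
    by rewrite big_nat_recr//= IH -natr1; have := SE m; lra.
  apply/ler_addgt0Pr => e e0.
  pose m := Num.truncn ((A + 2 * C) / e).
  have em : A + 2 * C < e * m.+1%:R.
    by rewrite [ltRHS]mulrC -ltr_pdivrMr// truncnS_gt.
  have := numerical_radius_flat m W_ub.
  rewrite ler_pdivrMl ?ltr0n// -/alpha sumS => wm.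
  rewrite -(@ler_pM2l _ m.+1%:R) ?ltr0n//.
  have := SC m; have := SC 0%N; rewrite !ler_norml => /andP[_ ?] /andP[? _].
  move: em wm; rewrite -natr1; nra.
split=> //.
- apply: le_lt_trans rhoA; rewrite /spectral_radius.
  (* A set with no supremum gets the value [0], which is below [rho]. *)
  set E := (X in sup X).
  have [[ne _]|/sup_out->] := pselect (has_sup E); last exact: ltW.
  by apply: ge_sup => // _ [z /sp zrho <-].
- move=> nrm.
  have : M <= op_norm (@ell2_dot R) (wshift a).
    apply: bigmax_le => [|k _]; last exact: op_norm_ge_weight.
    by apply: le_trans (op_norm_ge_weight a 0); exact: normc_ge0.
  by rewrite -nrm leNgt w_lt_M.
- move=> cvx.
  have /sup_gt : rho < wnorm a by exact: lt_le_trans A_le_w.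
  case=> [|_ [z Wz <-]].
    by eexists; eexists; [exact: (@numerical_range_flat _ a 0)|].
  by rewrite ltNge (convexoid_bound sp cvx Wz).
Qed.
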